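(* Let $\operatorname{Li}_2$ denote the dilogarithm and, for integers $k\ge 1$ and $|x|<1$, let $f_k(x)=\frac{1}{k}\,\Re\!\left[\sqrt{\operatorname{Li}_2(x^k)}\right]$. Let $U^+=\{x\in\mathbb{C}: |x|<1,\ \Im x>0\}$ and, for $k\in\{1,2,3\}$, let $\mathcal{R}(k)=\{x\in U^+ : f_k(x)\ge f_j(x)\text{ for all } j\in\{1,2,3\}\}$. Then: (a) For all $x$ with $|x|<1$ and all $k\ge 4$, $f_k(x)\le \max[f_1(x),f_2(x),f_3(x)]$. (b) For $x\in\mathcal{R}(1)$, $f_1(x)\ge f_k(x)$ for all $k\ge 2$. (c) For $x\in\mathcal{R}(2)$, $f_2(x)\ge f_k(x)$ for all $k\ge 3$ and for $k=1$. (d) For $x\in\mathcal{R}(3)$, $f_3(x)\ge f_k(x)$ for all $k\ge 4$ and for $k=1,2$.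
   Context: $\operatorname{Li}_2(x)=\sum_{n\ge1}x^n/n^2=-\int_0^x\frac{\ln(1-t)}{t}\,dt$ for $|x|\le 1$. The square root is the principal branch (note that $\Re\sqrt{w}=\sqrt{(|w|+\Re w)/2}$ is independent of the branch cut, so $f_k$ is well defined and continuous). *)

(* Defs.v *)
From Stdlib Require Import Reals Lra Lia.
From Coquelicot Require Import Coquelicot.
Open Scope R_scope.

(* The n-th term is x^(n+1)/(n+1)^2, so that summation starts at n = 0. *)
Definition Li2_term (x : C) (n : nat) : C :=
  (Cpow x (S n) / RtoC (INR (S n) ^ 2))%C.

(* [iota] picks the sum when the series converges, in particular for
   Cmod x <= 1 (see [Li2_correct]). *)
Definition Li2 (x : C) : C :=
  @iota C_CompleteNormedModule
    (fun l : C => @is_series C_AbsRing C_NormedModule (Li2_term x) l).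

(* Principal branch, cut along the negative real axis, where the argument of w
   is taken to be PI (see [Csqrt_sqr] and [Csqrt_principal]). *)
Definition Csqrt (w : C) : C :=
  (sqrt ((Cmod w + Re w) / 2),
   (if Rlt_dec (Im w) 0 then -1 else 1) * sqrt ((Cmod w - Re w) / 2)).

Definition fLi2 (k : nat) (x : C) : R := / INR k * Re (Csqrt (Li2 (Cpow x k))).

Definition Uplus (x : C) : Prop := Cmod x < 1 /\ 0 < Im x.

Definition region (k : nat) (x : C) : Prop :=
  Uplus x /\ forall j : nat, (1 <= j <= 3)%nat -> fLi2 k x >= fLi2 j x.

Lemma ex_series_inv_sqr : ex_series (fun n => / INR (S n) ^ 2).
Proof.
apply (@ex_series_le R_AbsRing R_CompleteNormedModule) with
  (b := fun n => 2 * (/ INR (S n) - / INR (S (S n)))).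
- intros n; change (Rabs (/ INR (S n) ^ 2) <= 2 * (/ INR (S n) - / INR (S (S n)))).
  assert (Hn : 1 <= INR (S n)) by (rewrite S_INR; generalize (pos_INR n); lra).
  rewrite (S_INR (S n)); set (a := INR (S n)) in *.
  rewrite Rabs_pos_eq by (left; apply Rinv_0_lt_compat; nra).
  assert (H : 2 * (/ a - / (a + 1)) - / a ^ 2 = (a - 1) * / (a ^ 2 * (a + 1)))
    by (field; lra).
  assert (0 <= / (a ^ 2 * (a + 1))) by (left; apply Rinv_0_lt_compat; nra).
  nra.
- exists (2 * 1); apply (is_series_scal_l (K:=R_AbsRing) 2 _ 1).
  change (is_lim_seq (sum_n (fun n => / INR (S n) - / INR (S (S n)))) 1).
  apply is_lim_seq_ext with (u := fun n => 1 - / INR (S (S n))).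
  + induction n as [|n IH].
    * rewrite sum_O; simpl INR; lra.
    * rewrite sum_Sn, <- IH.
      change (1 - / INR (S (S (S n))) = 1 - / INR (S (S n))
              + (/ INR (S (S n)) - / INR (S (S (S n))))); lra.
  + replace (Finite 1) with (Finite (1 - 0)) by (f_equal; ring).
    apply is_lim_seq_minus'; [apply is_lim_seq_const|].
    apply is_lim_seq_ext with (u := fun n => / INR (n + 2)).
    { intros n; do 2 f_equal; lia. }
    apply (is_lim_seq_incr_n (fun n => / INR n) 2).
    apply (is_lim_seq_inv INR p_infty); [apply is_lim_seq_INR | discriminate].
Qed.

Lemma Li2_correct (x : C) :
  Cmod x <= 1 -> @is_series C_AbsRing C_NormedModule (Li2_term x) (Li2 x).
Proof.
intros Hx.
assert (H : @ex_series C_AbsRing C_CompleteNormedModule (Li2_term x)).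
{ apply ex_series_le with (b := fun n => / INR (S n) ^ 2);
    [|apply ex_series_inv_sqr].
  intros n; change (Cmod (Li2_term x n) <= / INR (S n) ^ 2); unfold Li2_term.
  assert (Hn : 0 < INR (S n) ^ 2) by (apply pow_lt, lt_0_INR; lia).
  rewrite Cmod_div by (intros E; apply RtoC_inj in E; lra).
  rewrite Cmod_R, Rabs_pos_eq, Cmod_pow by lra.
  rewrite <- (Rmult_1_l (/ _)); apply Rmult_le_compat_r.
  - left; now apply Rinv_0_lt_compat.
  - rewrite <- (pow1 (S n)); apply pow_incr; split; [apply Cmod_ge_0 | exact Hx]. }
destruct H as [l Hl]; unfold Li2.
replace (iota _) with l; [exact Hl|].
symmetry.
apply (@iota_filterlim_locally C_AbsRing C_CompleteNormedModule nat eventually _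
  (@sum_n C_AbsRing (Li2_term x)) l Hl).
Qed.

Lemma Csqrt_sqr (w : C) : (Csqrt w * Csqrt w)%C = w.
Proof.
destruct w as [a b].
assert (H2 : Cmod (a, b) * Cmod (a, b) = a * a + b * b).
{ unfold Cmod; simpl fst; simpl snd; rewrite sqrt_sqrt; nra. }
assert (H0 := Cmod_ge_0 (a, b)).
unfold Csqrt, Cmult; simpl Re; simpl Im; set (m := Cmod (a, b)) in *.
assert (Hp : 0 <= (m + a) / 2) by nra.
assert (Hm : 0 <= (m - a) / 2) by nra.
assert (Hs : sqrt ((m + a) / 2) * sqrt ((m - a) / 2) = Rabs b / 2).
{ rewrite <- sqrt_mult by assumption.
  replace ((m + a) / 2 * ((m - a) / 2)) with (Rsqr (b / 2)) by (unfold Rsqr; nra).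
  rewrite sqrt_Rsqr_abs; unfold Rdiv; rewrite Rabs_mult, (Rabs_pos_eq (/ 2)); lra. }
assert (S1 := sqrt_sqrt _ Hp); assert (S2 := sqrt_sqrt _ Hm).
simpl fst; simpl snd.
set (u := sqrt ((m + a) / 2)) in *; set (v := sqrt ((m - a) / 2)) in *.
destruct (Rlt_dec b 0) as [Hb|Hb].
- rewrite Rabs_left in Hs by exact Hb; f_equal; nra.
- rewrite Rabs_pos_eq in Hs by lra; f_equal; nra.
Qed.

Lemma Csqrt_principal (w : C) :
  0 < Re (Csqrt w) \/ (Re (Csqrt w) = 0 /\ 0 <= Im (Csqrt w)).
Proof.
destruct (sqrt_pos ((Cmod w + Re w) / 2)) as [H|H]; [left; exact H|].
right; split; [symmetry; exact H|].
unfold Csqrt; simpl; destruct (Rlt_dec (Im w) 0) as [Hw|Hw].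
- exfalso; apply (Rlt_irrefl 0); rewrite H at 2; apply sqrt_lt_R0.
  destruct w as [a b]; simpl in *.
  assert (H2 : Cmod (a, b) * Cmod (a, b) = a * a + b * b).
  { unfold Cmod; simpl fst; simpl snd; rewrite sqrt_sqrt; nra. }
  assert (H0 := Cmod_ge_0 (a, b)); nra.
- rewrite Rmult_1_l; apply sqrt_pos.
Qed.

(* Main.v *)
(* Write r = |x| and [f_k(x) = sqrt (N(x^k) / 2) / k] with
   [N(x) = |Li2 x| + Re (Li2 x)].
   Since [N(x) >= Re ((1 + conj x / r) Li2 x)] and
   [Li2 x = x * int_0^1 (- ln s) / (1 - x s) ds], one gets
   [N(x) >= (r + Re x) * int_0^1 (- ln s) (1 - r s) / |1 - x s|^2 ds].
   The measure [- ln s ds] has mass 1 and mean 1/4, so an affine minorant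
   [a - b s] of the kernel yields [N(x) >= (r + Re x) (a - b/4)].
   Conversely [N(w) <= 4 |w|], improved to [2 |w|] when [Re w <= 0].  Comparing the
   two shows that already [f_k <= max (f_1, f_2)] for k >= 4: use [f_1] when
   [Re x >= -0.69 r] and [f_2] otherwise; only for k = 4 the sign of [Re x^4]
   matters.  Integration against [- ln s ds] is carried out on power series, as
   two successive averages [F |-> (1/t) int_0^t F]. *)
Require Import Defs.
From Stdlib Require Import Reals Lra Lia.
From Coquelicot Require Import Coquelicot.
Open Scope R_scope.

(** * Averages of power series *)

Definition PS_avg (u : nat -> R) (n : nat) : R := u n / INR (S n).

Lemma PS_Int_avg (u : nat -> R) (n : nat) : PS_Int u n = PS_incr_1 (PS_avg u) n.
Proof. destruct n; reflexivity. Qed.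

Lemma CV_radius_avg (u : nat -> R) : CV_radius (PS_avg u) = CV_radius u.
Proof.
rewrite <- CV_radius_incr_1, <- (CV_radius_Int u).
apply CV_radius_ext; intros n; symmetry; apply PS_Int_avg.
Qed.

(** Integrating the affine bound over [[0, t]] and dividing by [t] keeps [a] and halves the
    slope. *)
Lemma PSeries_avg_ge (u : nat -> R) (a b : R) :
  Rbar_lt 1 (CV_radius u) ->
  (forall t, 0 < t <= 1 -> a - b * t <= PSeries u t) ->
  forall t, 0 < t <= 1 -> a - b / 2 * t <= PSeries (PS_avg u) t.
Proof.
intros Hr Hu t Ht.
assert (Hrt : Rbar_lt (Rabs t) (CV_radius u)).
{ apply Rbar_le_lt_trans with (y := 1); [|exact Hr].
  simpl; rewrite Rabs_pos_eq; lra. }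
assert (HI := is_RInt_PSeries u t Hrt).
assert (HL : is_RInt (fun s => a - b * s) 0 t (a * t - b / 2 * t ^ 2)).
{ replace (a * t - b / 2 * t ^ 2)
    with (minus (a * t - b / 2 * t ^ 2) (a * 0 - b / 2 * 0 ^ 2))
    by (unfold minus, plus, opp; simpl; ring).
  apply (is_RInt_derive (fun s => a * s - b / 2 * s ^ 2)).
  - intros s _; auto_derive; [exact I | field].
  - intros s _; apply (@ex_derive_continuous R_AbsRing R_NormedModule).
    auto_derive; exact I. }
assert (Hle : a * t - b / 2 * t ^ 2 <= PSeries (PS_Int u) t).
{ apply (is_RInt_le _ _ 0 t _ _ (Rlt_le _ _ (proj1 Ht)) HL HI).
  intros s Hs; apply Hu; lra. }
rewrite (PSeries_ext _ _ t (PS_Int_avg u)), PSeries_incr_1 in Hle.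
apply Rmult_le_reg_l with t; [lra|].
replace (t * (a - b / 2 * t)) with (a * t - b / 2 * t ^ 2) by ring; exact Hle.
Qed.

(** Two averages, evaluated at 1, divide the coefficients by [(n+1)^2] and halve the slope twice;
    this 1/4 is the mean of [- ln s ds]. *)
Lemma Series_div_sqr_ge (u : nat -> R) (a b : R) :
  Rbar_lt 1 (CV_radius u) ->
  (forall t, 0 < t <= 1 -> a - b * t <= PSeries u t) ->
  a - b / 4 <= Series (fun n => u n / INR (S n) ^ 2).
Proof.
intros Hr Hu.
assert (H := PSeries_avg_ge _ a b Hr Hu).
apply PSeries_avg_ge with (t := 1) in H; [|rewrite CV_radius_avg; exact Hr|lra].
rewrite PSeries_1 in H.
replace (Series (fun n => u n / INR (S n) ^ 2)) with (Series (PS_avg (PS_avg u)));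
  [lra|].
apply Series_ext; intros n; unfold PS_avg; field; apply not_0_INR; lia.
Qed.

(** * Real parts of the dilogarithm series and the upper bound *)

Lemma is_series_Re (a : nat -> C) (l : C) :
  @is_series C_AbsRing C_NormedModule a l -> is_series (fun n => Re (a n)) (Re l).
Proof.
intros H.
apply filterlim_ext with (f := fun n => Re (@sum_n C_AbsRing a n)).
- intros n; induction n as [|n IH].
  + rewrite !sum_O; reflexivity.
  + rewrite !sum_Sn, <- IH; reflexivity.
- apply filterlim_comp with (G := locally l); [exact H|].
  apply (continuous_fst (U := R_UniformSpace) (V := R_UniformSpace)).
Qed.

(** The multiplier [A] will be [Cconj (Li2 x)] for the upper bound, [r + Cconj x] for the lower
    bound and -1 for the sign of [Re (Li2 x)]. *)
Lemma is_series_Re_Li2 (A x : C) : Cmod x <= 1 ->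
  is_series (fun n => Re (A * Cpow x (S n)) / INR (S n) ^ 2) (Re (A * Li2 x)).
Proof.
intros Hx.
assert (H := @is_series_scal C_AbsRing C_NormedModule A _ _ (Li2_correct x Hx)).
apply is_series_Re in H.
revert H; apply is_series_ext; intros n.
change (Re (A * Li2_term x n) = Re (A * Cpow x (S n)) / INR (S n) ^ 2).
assert (Hn : INR (S n) ^ 2 <> 0) by (apply pow_nonzero, not_0_INR; lia).
unfold Li2_term, Cdiv.
rewrite <- RtoC_inv, Cmult_assoc by exact Hn.
destruct (A * Cpow x (S n))%C; simpl; unfold Rdiv; ring.
Qed.

Lemma Re_le_Cmod (z : C) : Rabs (Re z) <= Cmod z.
Proof.
apply Rle_trans with (2 := Rmax_Cmod z); apply Rmax_l.
Qed.

(** Telescoping, from [1/(n+2)^2 <= 1/(n+1) - 1/(n+2)]. The crude 2 in place of [PI^2/6] leaves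
    enough room later. *)
Lemma Series_inv_sqr_le : Series (fun n => / INR (S n) ^ 2) <= 2.
Proof.
change (Rbar_le (Series (fun n => / INR (S n) ^ 2)) 2).
apply is_lim_seq_le with
  (u := sum_n (fun n => / INR (S n) ^ 2)) (v := fun n => 2 - / INR (S n)).
- induction n as [|n IH].
  + rewrite sum_O; simpl INR; lra.
  + rewrite sum_Sn.
    apply Rle_trans with (2 - / INR (S n) + / INR (S (S n)) ^ 2);
      [apply Rplus_le_compat_r; exact IH|].
    assert (Hn := pos_INR n); rewrite !S_INR; set (m := INR n) in *.
    assert (E : / (m + 1) - / (m + 1 + 1) - / (m + 1 + 1) ^ 2
                = / ((m + 1) * (m + 2) ^ 2)) by (field; lra).
    assert (0 < / ((m + 1) * (m + 2) ^ 2)); [|lra].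
    apply Rinv_0_lt_compat, Rmult_lt_0_compat; [|apply pow_lt]; lra.
- exact (Series_correct _ ex_series_inv_sqr).
- replace (Finite 2) with (Finite (2 - 0)) by (f_equal; ring).
  apply is_lim_seq_minus'; [apply is_lim_seq_const|].
  apply (is_lim_seq_incr_1 (fun n => / INR n)).
  apply (is_lim_seq_inv INR p_infty); [apply is_lim_seq_INR | discriminate].
Qed.

Lemma is_series_le (a b : nat -> R) (l m : R) :
  (forall n, a n <= b n) -> is_series a l -> is_series b m -> l <= m.
Proof.
intros H Ha Hb.
change (Rbar_le l m).
apply is_lim_seq_le with (2 := Ha) (3 := Hb).
intros n; apply sum_n_m_le; exact H.
Qed.

(** With [L = Li2 x], the number [|L|^2 = Re (conj L * L)] is a real series with terms at most
    [|L| |x| / (n+1)^2]; a factor [|L|] then cancels. *)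
Lemma Cmod_Li2_le (x : C) : Cmod x <= 1 -> Cmod (Li2 x) <= 2 * Cmod x.
Proof.
intros Hx; assert (Hx0 := Cmod_ge_0 x); assert (HL0 := Cmod_ge_0 (Li2 x)).
assert (Hser := is_series_Re_Li2 (Cconj (Li2 x)) x Hx).
assert (Hsq : Re (Cconj (Li2 x) * Li2 x) = Cmod (Li2 x) ^ 2).
{ rewrite Cmult_comm, <- Cmod2_conj; destruct (Li2 x); reflexivity. }
rewrite Hsq in Hser.
assert (H : Cmod (Li2 x) ^ 2 <= Cmod (Li2 x) * Cmod x * 2).
{ apply Rle_trans with (Cmod (Li2 x) * Cmod x * Series (fun n => / INR (S n) ^ 2)).
  - refine (is_series_le _ _ _ _ _ Hser
      (is_series_scal_l (Cmod (Li2 x) * Cmod x) _ _ (Series_correct _ ex_series_inv_sqr))).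
    intros n.
    apply Rmult_le_compat_r.
    { left; apply Rinv_0_lt_compat, pow_lt, lt_0_INR; lia. }
    apply Rle_trans with (1 := Rle_abs _), Rle_trans with (1 := Re_le_Cmod _).
    rewrite Cmod_mult, Cmod_conj, Cmod_pow.
    apply Rmult_le_compat_l; [exact HL0|].
    rewrite <- (Rmult_1_r (Cmod x)) at 2; simpl.
    apply Rmult_le_compat_l; [exact Hx0|].
    rewrite <- (pow1 n); apply pow_incr; split; assumption.
  - apply Rmult_le_compat_l; [nra | exact Series_inv_sqr_le]. }
destruct (Rle_lt_or_eq_dec _ _ HL0) as [H0|H0]; [nra|lra].
Qed.

(** * The rational kernel and the lower bounds *)

Lemma CV_radius_geom_bound (u : nat -> R) (M r : R) :
  0 <= r < 1 -> (forall n, Rabs (u n) <= M * r ^ n) -> Rbar_lt 1 (CV_radius u).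
Proof.
intros Hr Hu.
assert (HM : 0 <= M).
{ specialize (Hu O); simpl in Hu; assert (H := Rabs_pos (u O)); lra. }
(* [2 / (1 + r)] exceeds 1, yet its product with [r] is at most 1, so the terms at this point stay
   bounded by [M]. *)
apply Rbar_lt_le_trans with (y := 2 / (1 + r)).
- simpl; apply Rmult_lt_reg_r with (1 + r); [lra|].
  unfold Rdiv; rewrite Rmult_assoc, Rinv_l; lra.
- apply (proj1 (CV_radius_bounded u)); exists M; intros n.
  assert (Hq : 0 <= 2 / (1 + r)).
  { apply Rmult_le_pos; [lra | left; apply Rinv_0_lt_compat; lra]. }
  assert (Hrq : r * (2 / (1 + r)) <= 1).
  { apply Rmult_le_reg_r with (1 + r); [lra|].
    replace (r * (2 / (1 + r)) * (1 + r)) with (2 * r) by (field; lra); lra. }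
  rewrite Rabs_mult, (Rabs_pos_eq (_ ^ n)) by now apply pow_le.
  apply Rle_trans with (M * r ^ n * (2 / (1 + r)) ^ n).
  + apply Rmult_le_compat_r; [now apply pow_le | apply Hu].
  + rewrite Rmult_assoc, <- Rpow_mult_distr.
    rewrite <- (Rmult_1_r M) at 2; apply Rmult_le_compat_l; [exact HM|].
    apply Rle_trans with (1 ^ n); [|rewrite pow1; apply Rle_refl].
    apply pow_incr; split; [apply Rmult_le_pos; [apply Hr | exact Hq] | exact Hrq].
Qed.

(** The sum is [Re (A x / (1 - x t))], with the denominator [|1 - x t|^2] cleared. It follows from
    the recurrence [u_(n+2) = 2 Re x u_(n+1) - |x|^2 u_n], as [x] is a root of
    [X^2 - 2 Re x X + |x|^2]. *)
Lemma PSeries_Re_geom (A x : C) (t : R) :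
  Rbar_lt (Rabs t) (CV_radius (fun n => Re (A * Cpow x (S n)))) ->
  PSeries (fun n => Re (A * Cpow x (S n))) t
    * (1 - 2 * Re x * t + Cmod x ^ 2 * t ^ 2)
  = Re (A * x) - Re A * Cmod x ^ 2 * t.
Proof.
intros Ht.
set (u := fun n => Re (A * Cpow x (S n))) in *.
assert (E := CV_radius_inside u t Ht).
assert (E1 : ex_pseries (PS_decr_1 u) t).
{ apply CV_radius_inside; rewrite CV_radius_decr_1; exact Ht. }
assert (H0 := PSeries_decr_1 u t E).
assert (H1 := PSeries_decr_1 _ t E1).
assert (H2 : PSeries (PS_decr_1 (PS_decr_1 u)) t
   = 2 * Re x * PSeries (PS_decr_1 u) t - Cmod x ^ 2 * PSeries u t).
{ rewrite (PSeries_ext _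
    (PS_minus (PS_scal (2 * Re x) (PS_decr_1 u)) (PS_scal (Cmod x ^ 2) u))).
  - rewrite PSeries_minus, !PSeries_scal; [reflexivity| |].
    + now apply ex_pseries_scal; [apply Rmult_comm|].
    + now apply ex_pseries_scal; [apply Rmult_comm|].
  - intros n.
    change (u (S (S n)) = 2 * Re x * u (S n) - Cmod x ^ 2 * u n); unfold u.
    rewrite Cmod2_alt; simpl Cpow.
    destruct A as [a1 a2], x as [x1 x2], (Cpow (x1, x2) n) as [w1 w2].
    unfold Cmult, Re, Im; simpl; ring. }
assert (U0 : u 0%nat = Re (A * x)) by (unfold u; now rewrite Cpow_1_r).
assert (U1 : PS_decr_1 u 0%nat = 2 * Re x * Re (A * x) - Re A * Cmod x ^ 2).
{ unfold PS_decr_1, u; rewrite Cmod2_alt; simpl.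
  destruct A as [a1 a2], x as [x1 x2]; unfold Cmult, Re, Im; simpl; ring. }
rewrite U0 in H0; rewrite U1, H2 in H1.
set (P := PSeries u t) in *; set (P1 := PSeries (PS_decr_1 u) t) in *.
assert (H3 : t * P1 = P - Re (A * x)) by lra.
replace (P * (1 - 2 * Re x * t + Cmod x ^ 2 * t ^ 2))
  with (P - 2 * Re x * t * P + Cmod x ^ 2 * t ^ 2 * P) by ring.
assert (H4 : t * P1 = t * (2 * Re x * Re (A * x) - Re A * Cmod x ^ 2)
  + 2 * Re x * t * (t * P1) - Cmod x ^ 2 * t ^ 2 * P).
{ rewrite H1 at 1; ring. }
rewrite H3 in H4; lra.
Qed.

Lemma Re_mul_Li2_ge (A x : C) (a b : R) :
  Cmod x < 1 ->
  (forall t, 0 < t <= 1 ->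
     (a - b * t) * (1 - 2 * Re x * t + Cmod x ^ 2 * t ^ 2)
     <= Re (A * x) - Re A * Cmod x ^ 2 * t) ->
  a - b / 4 <= Re (A * Li2 x).
Proof.
intros Hx H; assert (Hx0 := Cmod_ge_0 x).
rewrite <- (is_series_unique _ _ (is_series_Re_Li2 A x (Rlt_le _ _ Hx))).
assert (HR : Rbar_lt 1 (CV_radius (fun n => Re (A * Cpow x (S n))))).
{ apply CV_radius_geom_bound with (M := Cmod A * Cmod x) (r := Cmod x); [lra|].
  intros n; apply Rle_trans with (1 := Re_le_Cmod _).
  rewrite Cmod_mult, Cmod_pow; simpl; lra. }
apply (Series_div_sqr_ge (fun n => Re (A * Cpow x (S n)))); [exact HR|].
intros t Ht; specialize (H t Ht).
assert (HRt : Rbar_lt (Rabs t) (CV_radius (fun n => Re (A * Cpow x (S n))))).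
{ apply Rbar_le_lt_trans with (y := 1); [|exact HR].
  simpl; rewrite Rabs_pos_eq; lra. }
rewrite <- (PSeries_Re_geom A x t HRt) in H.
apply Rmult_le_reg_r with (2 := H).
assert (HX : Rabs (Re x) <= Cmod x) by apply Re_le_Cmod.
apply Rabs_le_between in HX.
(* The cleared denominator is at least this square. *)
assert (0 < (1 - Cmod x * t) ^ 2) by (apply pow_lt; nra).
nra.
Qed.

Lemma Re_Li2_nonpos (x : C) : Cmod x < 1 -> Re x <= 0 -> Re (Li2 x) <= 0.
Proof.
intros Hx Hre; assert (Hx0 := Cmod_ge_0 x).
assert (H : 0 - 0 / 4 <= Re (RtoC (-1) * Li2 x)).
{ apply Re_mul_Li2_ge; [exact Hx|]; intros t Ht.
  rewrite re_scal_l; simpl Re at 3; nra. }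
rewrite re_scal_l in H; lra.
Qed.

(* The hypothesis on [a], [b] says that [a - b s] minorizes
   [(1 - s) / (1 - 2 c s + s^2)], the kernel at [|x| = 1], [cos (arg x) = c]. *)
Lemma Cmod_plus_Re_Li2_ge (x : C) (c a b : R) :
  Cmod x < 1 -> 0 <= b -> c * Cmod x <= Re x ->
  (forall s, 0 <= s <= 1 -> (a - b * s) * (1 - 2 * c * s + s ^ 2) <= 1 - s) ->
  (Cmod x + Re x) * (a - b / 4) <= Cmod (Li2 x) + Re (Li2 x).
Proof.
intros Hx Hb Hc H; assert (Hx0 := Cmod_ge_0 x).
destruct (Rle_lt_or_eq_dec _ _ Hx0) as [H0|H0].
2:{ assert (HX := Re_le_Cmod x); apply Rabs_le_between in HX.
    assert (HL := Re_le_Cmod (Li2 x)); apply Rabs_le_between in HL.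
    replace (Cmod x + Re x) with 0 by lra; lra. }
assert (HX := Re_le_Cmod x); apply Rabs_le_between in HX.
set (r := Cmod x) in *.
(* Multiplier [r + conj x]: it makes both terms of the kernel's numerator multiples of [r + Re x],
   giving [r (r + Re x) (1 - r t)]. *)
assert (Hlow : r * (r + Re x) * a - r * (r + Re x) * b / 4
               <= Re ((RtoC r + Cconj x) * Li2 x)).
{ apply Re_mul_Li2_ge; [exact Hx|]; intros t Ht.
  fold r.
  assert (EA : Re (RtoC r + Cconj x) = r + Re x) by (destruct x; reflexivity).
  assert (EB : Re ((RtoC r + Cconj x) * x) = r * (r + Re x)).
  { replace (r * (r + Re x)) with (r * Re x + r ^ 2) by ring.
    unfold r at 3; rewrite Cmod2_alt; destruct x; unfold Cmult, Re, Im; simpl; ring. }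
  rewrite EA, EB.
  (* The substitution [s = r t] reduces to the kernel on the unit circle. *)
  assert (Hs : 0 <= r * t <= 1) by nra.
  specialize (H (r * t) Hs).
  assert (HD : 0 < 1 - 2 * Re x * t + r ^ 2 * t ^ 2).
  { assert (0 < (1 - r * t) ^ 2) by (apply pow_lt; nra). nra. }
  assert (HDc : 1 - 2 * Re x * t + r ^ 2 * t ^ 2
                <= 1 - 2 * c * (r * t) + (r * t) ^ 2) by nra.
  assert (Hab : (a - b * t) <= a - b * (r * t)).
  { assert (0 <= b * ((1 - r) * t)) by (apply Rmult_le_pos; nra). nra. }
  assert (Hmain : (a - b * t) * (1 - 2 * Re x * t + r ^ 2 * t ^ 2) <= 1 - r * t).
  (* A nonpositive minorant is trivial; a positive one allows the denominator to be enlarged by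
     [HDc]. *)
  { destruct (Rle_dec (a - b * t) 0); nra. }
  assert (0 <= r * (r + Re x)) by nra.
  apply Rmult_le_compat_l with (r := r * (r + Re x)) in Hmain; [|assumption].
  lra. }
assert (Hup : Re ((RtoC r + Cconj x) * Li2 x) <= r * (Cmod (Li2 x) + Re (Li2 x))).
{ replace (Re ((RtoC r + Cconj x) * Li2 x))
    with (r * Re (Li2 x) + Re (Cconj x * Li2 x))
    by (destruct x, (Li2 _); unfold Cmult, Re, Im; simpl; ring).
  assert (Hc2 := Re_le_Cmod (Cconj x * Li2 x)); apply Rabs_le_between in Hc2.
  rewrite Cmod_mult, Cmod_conj in Hc2; fold r in Hc2; lra. }
apply Rmult_le_reg_l with r; [exact H0|]; lra.
Qed.

(** * Comparison of the functions [fLi2] *)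

Lemma fLi2_le (x : C) (j k : nat) : (1 <= j)%nat -> (1 <= k)%nat ->
  INR j ^ 2 * (Cmod (Li2 (Cpow x k)) + Re (Li2 (Cpow x k)))
    <= INR k ^ 2 * (Cmod (Li2 (Cpow x j)) + Re (Li2 (Cpow x j))) ->
  fLi2 k x <= fLi2 j x.
Proof.
intros Hj Hk H.
change (/ INR k * sqrt ((Cmod (Li2 (Cpow x k)) + Re (Li2 (Cpow x k))) / 2)
        <= / INR j * sqrt ((Cmod (Li2 (Cpow x j)) + Re (Li2 (Cpow x j))) / 2)).
apply le_INR in Hj, Hk; simpl INR in Hj, Hk.
assert (HL := Re_le_Cmod (Li2 (Cpow x k))); apply Rabs_le_between in HL.
assert (HL' := Re_le_Cmod (Li2 (Cpow x j))); apply Rabs_le_between in HL'.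
set (p := Cmod (Li2 (Cpow x k)) + Re (Li2 (Cpow x k))) in *.
set (q := Cmod (Li2 (Cpow x j)) + Re (Li2 (Cpow x j))) in *.
assert (Hp : 0 <= p / 2) by (unfold p; lra).
assert (Hq : 0 <= q / 2) by (unfold q; lra).
set (m := INR j) in *; set (n := INR k) in *.
assert (Hmn : m * sqrt (p / 2) <= n * sqrt (q / 2)).
{ assert (S1 := sqrt_pos (p / 2)); assert (S2 := sqrt_pos (q / 2)).
  apply Rsqr_incr_0_var; [|apply Rmult_le_pos; lra].
  rewrite !Rsqr_mult, !Rsqr_sqrt by assumption; unfold Rsqr; lra. }
apply Rmult_le_reg_l with (m * n); [nra|].
replace (m * n * (/ n * sqrt (p / 2))) with (m * sqrt (p / 2)) by (field; lra).
replace (m * n * (/ m * sqrt (q / 2))) with (n * sqrt (q / 2)) by (field; lra).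
exact Hmn.
Qed.

Lemma Re_sqr (x : C) : Re (x * x) = 2 * Re x ^ 2 - Cmod x ^ 2.
Proof. rewrite Cmod2_alt, re_mult; ring. Qed.

Lemma Cmod_plus_Re_Li2_le (x : C) :
  Cmod x < 1 -> Cmod (Li2 x) + Re (Li2 x) <= 4 * Cmod x.
Proof.
intros Hx; assert (H := Cmod_Li2_le x (Rlt_le _ _ Hx)).
assert (HL := Re_le_Cmod (Li2 x)); apply Rabs_le_between in HL; lra.
Qed.

Lemma fLi2_le_max12 (x : C) (k : nat) : Cmod x < 1 -> (4 <= k)%nat ->
  fLi2 k x <= fLi2 1 x \/ fLi2 k x <= fLi2 2 x.
Proof.
intros Hx Hk; assert (Hx0 := Cmod_ge_0 x).
assert (HX := Re_le_Cmod x); apply Rabs_le_between in HX.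
assert (E2 : Cpow x 2 = (x * x)%C) by (simpl; now rewrite Cmult_1_r).
assert (M2 : Cmod (x * x) = Cmod x ^ 2) by (rewrite Cmod_mult; ring).
assert (R2 := Re_sqr x).
set (r := Cmod x) in *; set (X := Re x) in *.
assert (Hpow : forall n, (k = S (S n)) -> r ^ k <= r ^ 2).
{ intros n ->; replace (r ^ S (S n)) with (r ^ 2 * r ^ n) by (simpl; ring).
  rewrite <- (Rmult_1_r (r ^ 2)) at 2; apply Rmult_le_compat_l; [nra|].
  apply Rle_trans with (1 ^ n); [|rewrite pow1; apply Rle_refl].
  apply pow_incr; lra. }
specialize (Hpow (k - 2)%nat ltac:(lia)).
assert (Mk : Cmod (Cpow x k) = r ^ k) by apply Cmod_pow.
assert (Hr2 : r ^ 2 <= r) by nra.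
assert (Up := Cmod_plus_Re_Li2_le (Cpow x k)); rewrite Mk in Up.
specialize (Up ltac:(lra)).
(* The second hypothesis says [Re (x^4) <= 0], since [Re (x^2) = 2 X^2 - r^2]. *)
assert (Up4 : k = 4%nat -> 2 * (2 * X ^ 2 - r ^ 2) ^ 2 <= r ^ 4 ->
  Cmod (Li2 (Cpow x k)) + Re (Li2 (Cpow x k)) <= 2 * r ^ k).
{ intros Ek Hre.
  assert (HL := Cmod_Li2_le (Cpow x k)); rewrite Mk in HL.
  assert (Hneg := Re_Li2_nonpos (Cpow x k)); rewrite Mk in Hneg.
  specialize (HL ltac:(lra)).
  assert (Re (Cpow x k) <= 0).
  { subst k; replace (Cpow x 4) with ((x * x) * (x * x))%C by (simpl; ring).
    rewrite Re_sqr, M2, R2; lra. }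
  specialize (Hneg ltac:(lra) ltac:(assumption)); lra. }
destruct (Rle_dec (-0.69 * r) X) as [HA|HA].
- left; apply fLi2_le; [lia|lia|]; rewrite Cpow_1_r.
  assert (Low : (r + X) * (0.888 - 1.422 / 4) <= Cmod (Li2 x) + Re (Li2 x)).
  { apply (Cmod_plus_Re_Li2_ge x (-0.69)); [exact Hx|lra|exact HA|].
    (* [0.888 - 1.422 s] is nearly the tangent of the kernel at the mean [1/4]
       of [- ln s ds]. *)
    intros s Hs.
    (* The cubic required to be nonnegative exceeds this product by [0.000415 + 0.000365 s]. *)
    assert (0 <= (s - 1 / 4) ^ 2 * (1.422 * s + 1.78536)); [|lra].
    apply Rmult_le_pos; [apply pow2_ge_0 | lra]. }
  simpl (INR 1).
  destruct (Nat.eq_dec k 4) as [->|Hk4].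
  + simpl (INR 4).
    destruct (Rle_dec (2 * (2 * X ^ 2 - r ^ 2) ^ 2) (r ^ 4)) as [HB|HB].
    * specialize (Up4 eq_refl HB); nra.
    (* [Re (x^4) > 0] forces [|X| / r] below [sin (PI/8) = 0.3827...] or above
       [cos (PI/8) = 0.9238...]; then [16 * 0.5325 * 0.61 > 4]. *)
    * assert (-0.39 * r <= X); [|nra].
      destruct (Rle_dec (-0.39 * r) X) as [HC|HC]; [exact HC|].
      exfalso; apply HB.
      assert (0.152 * r ^ 2 <= X ^ 2 <= 0.4762 * r ^ 2) by (split; nra).
      nra.
  + assert (5 <= INR k) by (replace 5 with (INR 5) by (simpl; lra); apply le_INR; lia).
    (* Here [25 * 0.5325 * 0.31 > 4], with little to spare. *)
    assert (25 <= INR k ^ 2) by nra.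
    nra.
- right; apply fLi2_le; [lia|lia|]; rewrite E2.
  set (Y := Re (x * x)) in *.
  (* [-0.0478 = 2 * 0.69^2 - 1]; it is rounded to -0.05 for the kernel. *)
  assert (HY : -0.0478 * r ^ 2 <= Y) by (rewrite R2; nra).
  assert (Low : (r ^ 2 + Y) * (1 - 1.26 / 4)
                <= Cmod (Li2 (x * x)) + Re (Li2 (x * x))).
  { unfold Y; rewrite <- M2; apply (Cmod_plus_Re_Li2_ge (x * x) (-0.05));
      [rewrite M2; nra|lra|rewrite M2; fold Y; nra|].
    intros s Hs.
    (* An exact factorization; the quadratic has its positive minimum near 0.347. *)
    assert (0 <= s * (0.16 - 0.874 * s + 1.26 * s ^ 2)); [|lra].
    apply Rmult_le_pos; [lra|]; assert (0 <= (s - 0.347) ^ 2) by apply pow2_ge_0; lra. }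
  simpl (INR 2).
  destruct (Nat.eq_dec k 4) as [->|Hk4].
  + simpl (INR 4).
    destruct (Rle_dec (2 * (2 * X ^ 2 - r ^ 2) ^ 2) (r ^ 4)) as [HB|HB].
    * specialize (Up4 eq_refl HB); nra.
    * rewrite <- R2 in HB.
      (* [Re (x^4) > 0] means [|Y| > r^2 / sqrt 2], and [HY] excludes the negative sign. *)
      assert (0.7 * r ^ 2 <= Y); [|nra].
      destruct (Rle_dec (0.7 * r ^ 2) Y) as [HC|HC]; [exact HC|].
      exfalso; apply HB; nra.
  + assert (5 <= INR k) by (replace 5 with (INR 5) by (simpl; lra); apply le_INR; lia).
    (* Here [25 * 0.685 * 0.9522 > 16 = 4 * 4]. *)
    assert (25 <= INR k ^ 2) by nra.
    nra.
Qed.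

Theorem theorem2 :
  (forall (x : C) (k : nat), Cmod x < 1 -> (4 <= k)%nat ->
     fLi2 k x <= Rmax (Rmax (fLi2 1 x) (fLi2 2 x)) (fLi2 3 x))
  /\
  (forall x : C, region 1 x ->
     forall k : nat, (2 <= k)%nat -> fLi2 1 x >= fLi2 k x)
  /\
  (forall x : C, region 2 x ->
     forall k : nat, ((3 <= k)%nat \/ k = 1%nat) -> fLi2 2 x >= fLi2 k x)
  /\
  (forall x : C, region 3 x ->
     forall k : nat, ((4 <= k)%nat \/ k = 1%nat \/ k = 2%nat) -> fLi2 3 x >= fLi2 k x).
Proof.
(* Parts (b) to (d) at once: for [k >= 4] the bound by [f_1] or [f_2] passes to the dominant
   [f_j]. *)
assert (Hreg : forall (j : nat) (x : C), region j x ->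
  forall k : nat, (1 <= k)%nat -> fLi2 j x >= fLi2 k x).
{ intros j x [[Hx _] Hj] k Hk.
  assert (H1 := Hj 1%nat ltac:(lia)); assert (H2 := Hj 2%nat ltac:(lia)).
  destruct (Compare_dec.le_lt_dec 4 k) as [Hk4|Hk4]; [|apply Hj; lia].
  destruct (fLi2_le_max12 x k Hx Hk4); lra. }
split; [|repeat split; intros x Hx k Hk; apply Hreg; [exact Hx|lia|exact Hx|lia|exact Hx|lia]].
intros x k Hx Hk.
apply Rle_trans with (2 := Rmax_l _ _).
destruct (fLi2_le_max12 x k Hx Hk) as [H|H]; apply Rle_trans with (1 := H);
  [apply Rmax_l | apply Rmax_r].
Qed.
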